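(* Let $\mathcal{G}$ be a hereditary class of finite simple graphs, and suppose that the forbidden induced subgraphs for $\mathcal{G}$ have bounded order; let $c$ denote the maximum number of vertices of a forbidden induced subgraph for $\mathcal{G}$. Then every forbidden induced subgraph for the apex class $\mathcal{G}^{\mathrm{apex}}$ has at most $\lfloor \frac14 (c+2)^2 \rfloor$ vertices.
   Context: All graphs are finite, simple and undirected. An induced subgraph of $G$ is obtained by deleting vertices; for $T\subseteq V(G)$, $G[T]$ denotes the subgraph induced on $T$. A class of graphs is hereditary if it is closed under taking induced subgraphs (and isomorphism). For a hereditary class $\mathcal{G}$, a graph $H$ is a forbidden induced subgraph for $\mathcal{G}$ if $H\notin\mathcal{G}$ but every proper induced subgraph of $H$ lies in $\mathcal{G}$. The apex class $\mathcal{G}^{\mathrm{apex}}$ is the class of graphs $G$ having a vertex $v$ such that $G-v\in\mathcal{G}$ (it is hereditary when $\mathcal{G}$ is). *)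

(* Defs.v *)
From mathcomp Require Import all_boot.

Set Implicit Arguments.
Unset Strict Implicit.
Unset Printing Implicit Defensive.

Record sgraph := SGraph {
  vertex :> finType;
  adj : rel vertex;
  adj_sym : symmetric adj;
  adj_irrefl : irreflexive adj }.

Arguments adj {s} x y.

Section Induced.
Variables (G : sgraph) (T : {set G}).

Definition induced_adj : rel {x : G | x \in T} :=
  fun x y => adj (val x) (val y).

Lemma induced_adj_sym : symmetric induced_adj.
Proof. by move=> x y; apply: adj_sym. Qed.

Lemma induced_adj_irrefl : irreflexive induced_adj.
Proof. by move=> x; apply: adj_irrefl. Qed.

Definition induced : sgraph := SGraph induced_adj_sym induced_adj_irrefl.
End Induced.

Definition del_vertex (G : sgraph) (v : G) : sgraph := induced [set~ v].

Definition isomorphic (G H : sgraph) : Prop :=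
  exists2 f : G -> H, bijective f & forall x y, adj (f x) (f y) = adj x y.

Definition graph_class := sgraph -> Prop.

Definition hereditary (C : graph_class) : Prop :=
  (forall G H : sgraph, isomorphic G H -> C G -> C H) /\
  (forall (G : sgraph) (T : {set G}), C G -> C (induced T)).

Definition forbidden (C : graph_class) (H : sgraph) : Prop :=
  ~ C H /\ (forall T : {set H}, T \proper [set: H] -> C (induced T)).

(* The graph without vertices has no vertex to delete and is put in the apex
   class by convention.  Otherwise the apex class would not be hereditary: the
   null graph would be its only forbidden induced subgraph. *)
Definition apex (C : graph_class) : graph_class :=
  fun G => #|G| = 0 \/ exists v : G, C (del_vertex v).

Definition bounded_order (P : graph_class) : Prop :=
  exists b : nat, forall H : sgraph, P H -> #|H| <= b.

(* As for \max, the maximum over an empty family is 0. *)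
Definition is_max_order (P : graph_class) (c : nat) : Prop :=
  (forall H : sgraph, P H -> #|H| <= c) /\
  ((exists2 H : sgraph, P H & #|H| = c) \/
   ((forall H : sgraph, ~ P H) /\ c = 0)).

(* Main.v *)
(** Call a set of vertices of [H] bad if it induces a graph outside [C]; minimal
    bad sets induce forbidden subgraphs, so they have at most [c] vertices.
    That [H] is not apex says that no vertex lies in all minimal bad sets.
    Choose a minimal subfamily of [k] minimal bad sets that still has no common
    vertex: criticality of [H] forces it to cover [H].  By minimality each
    member [e] misses a vertex [w e] common to all the other members, so [e]
    contains the [k - 1] vertices [w e'] for [e' != e] and at most [c - (k - 1)]
    others.  Hence [H] has at most [k + k (c + 1 - k) = k (c + 2 - k)]
    vertices, which is at most [(c + 2)^2 / 4] by AM-GM. *)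
Require Import Defs.
From mathcomp Require Import all_boot.
From mathcomp Require Import boolp.

Set Implicit Arguments.
Unset Strict Implicit.
Unset Printing Implicit Defensive.

Lemma leq_mul_div4_sqr (m n : nat) : m * n <= (m + n) ^ 2 %/ 4.
Proof. by rewrite leq_divRL // mulnC nat_AGM2. Qed.

Lemma cover_critical_card (T : finType) (F : {set {set T}}) (c : nat)
    (w : {set T} -> T) :
  (forall e, e \in F -> #|e| <= c) ->
  (forall e, e \in F -> w e \notin e) ->
  (forall e e', e \in F -> e' \in F -> e' != e -> w e \in e') ->
  #|cover F| <= (c + 2) ^ 2 %/ 4.
Proof.
move=> leFc wNe wIe; pose W := w @: F.
have w_inj : {in F &, injective w}.
  move=> e e' eF e'F eq_w; apply/eqP/negPn/negP => neq_ee'.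
  by move: (wNe _ eF); rewrite eq_w (wIe e' e).
have cardW : #|W| = #|F| by apply: card_in_imset.
have [->|[e0 e0F]] := set_0Vmem F; first by rewrite /cover big_set0 cards0.
have cardI e : e \in F -> #|e :&: W| = #|F|.-1.
  move=> eF; suff -> : e :&: W = W :\ w e.
    by rewrite -cardW (cardsD1 (w e) W) imset_f.
  apply/setP => x; rewrite !inE andbC [RHS]andbC.
  case: imsetP => //= -[e' e'F ->]; have [->|neq_ee'] := eqVneq e e'.
    by rewrite eqxx (negPf (wNe _ e'F)).
  by rewrite (wIe e' e) // (inj_in_eq w_inj) // eq_sym.
have cardD e : e \in F -> #|e :\: W| <= c - #|F|.-1.
  by move=> eF; rewrite cardsD cardI // leq_sub2r // leFc.
(* This makes the truncated subtraction [c - #|F|.-1] a true difference, as the final arithmetic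
   requires. *)
have ltFc : #|F|.-1 <= c.
  by rewrite -(cardI e0) // (leq_trans _ (leFc _ e0F)) // subset_leq_card ?subsetIl.
have F_gt0 : 0 < #|F| by apply/card_gt0P; exists e0.
(* The witnesses in [W] are counted once overall rather than once in each member. *)
have subU : cover F \subset W :|: \bigcup_(e in F) (e :\: W).
  apply/bigcupsP => e eF; apply/subsetP => x xe; rewrite inE.
  case: (boolP (x \in W)) => //= xNW.
  by apply/bigcupP; exists e => //; rewrite inE xNW.
apply: leq_trans (subset_leq_card subU) _.
apply: leq_trans (leq_card_setU _ _) _; rewrite cardW.
apply: (@leq_trans (#|F| + #|F| * (c - #|F|.-1))).
  rewrite leq_add2l -sum_nat_const.
  apply: leq_trans (_ : \sum_(e in F) #|e :\: W| <= _); last exact: leq_sum.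
  elim/big_rec2: _ => [|e n A eF leAn]; first by rewrite cards0.
  by apply: leq_trans (leq_card_setU _ _) _; rewrite leq_add2l.
(* With [k = #|F|], the bound is the product of [k] and [c - (k - 1) + 1], two factors whose sum is
   [c + 2]. *)
rewrite -mulnS -{2}(subnKC ltFc) -addnA addn2 -addSnnS prednK //.
exact: leq_mul_div4_sqr.
Qed.

Lemma exists_small_subfamily (T : finType) (F : {set {set T}}) (c : nat) :
  (forall e, e \in F -> #|e| <= c) ->
  (forall v, exists2 e, e \in F & v \notin e) ->
  exists F' : {set {set T}},
    [/\ F' \subset F, forall v, exists2 e, e \in F' & v \notin e
      & #|cover F'| <= (c + 2) ^ 2 %/ 4].
Proof.
move=> leFc F_free.
pose free (A : {set {set T}}) := [forall v, [exists e in A, v \notin e]].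
have freeP (A : {set {set T}}) :
    reflect (forall v, exists2 e, e \in A & v \notin e) (free A).
  by apply: (iffP forallP) => freeA v; apply/exists_inP.
have [F' /minsetP[free_F' minF'] sF'F] := minset_exists (introT (freeP F) F_free).
have missing e : e \in F' ->
    exists v, (v \notin e) && [forall e' in F', (e' != e) ==> (v \in e')].
  (* By minimality, the family without [e] has a common vertex [v]; it avoids [e], since otherwise
     all of [F'] would share it. *)
  move=> eF'; have /forallPn[v /exists_inPn vI] : ~~ free (F' :\ e).
    apply/negP => /minF' /(_ (subD1set _ _)) eqF'.
    by move: eF'; rewrite -eqF' !inE eqxx.
  have vI' e' : e' \in F' -> e' != e -> v \in e'.
    by move=> e'F' neq; rewrite -[_ \in _]negbK vI // !inE neq.
  exists v; apply/andP; split.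
    have [e' e'F' vNe'] := (freeP _ free_F') v.
    by have [<-//|/(vI' _ e'F')] := eqVneq e' e; rewrite (negPf vNe').
  by apply/forall_inP => e' e'F'; apply/implyP; apply: vI'.
exists F'; split=> //; first exact/freeP.
have [->|[e0 e0F']] := set_0Vmem F'; first by rewrite /cover big_set0 cards0.
have [v0 _] := missing e0 e0F'.
(* The default [v0] only makes [w] total: on [F'] the [pick] succeeds by [missing]. *)
pose w (e : {set T}) := odflt v0
  [pick v | (v \notin e) && [forall e' in F', (e' != e) ==> (v \in e')]].
have wP e : e \in F' ->
    (w e \notin e) && [forall e' in F', (e' != e) ==> (w e \in e')].
  move=> eF'; rewrite /w; case: pickP => [//|none].
  by have [v] := missing e eF'; rewrite none.
apply: (@cover_critical_card _ _ _ w) => [e /(subsetP sF'F)|e|e e'].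
- exact: leFc.
- by case/wP/andP.
- by case/wP/andP=> _ /forall_inP wI e'F'; apply/implyP/wI.
Qed.

Lemma card_induced (G : sgraph) (T : {set G}) : #|induced T| = #|T|.
Proof. by rewrite card_sig; apply: eq_card. Qed.

Lemma isomorphic_sym (G H : sgraph) : isomorphic G H -> isomorphic H G.
Proof.
case=> f [g fK gK] f_adj; exists g; first by exists f.
by move=> x y; rewrite -f_adj !gK.
Qed.

(** Flattens nested subgraphs, so that later arguments compare subsets of a single graph. *)
Lemma induced_induced_iso (G : sgraph) (T : {set G}) (S : {set induced T})
    (U : {set G}) :
  U = val @: S -> isomorphic (induced S) (induced U).
Proof.
move=> defU.
have inU (x : induced S) : val (val x) \in U by rewrite defU imset_f // (valP x).
exists (fun x => exist (fun y => y \in U) (val (val x)) (inU x)) => //.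
apply: inj_card_bij.
  by move=> x y /(congr1 val)/= /val_inj/val_inj.
by rewrite !card_induced defU card_imset //; apply: val_inj.
Qed.

Section Hereditary.
Variable C : graph_class.
Hypothesis hereditaryC : hereditary C.

Lemma hereditary_induced_induced (G : sgraph) (T : {set G})
    (S : {set induced T}) :
  C (induced S) <-> C (induced (val @: S : {set G})).
Proof.
have isoS := @induced_induced_iso G T S _ erefl.
by split; apply: hereditaryC.1 => //; apply: isomorphic_sym.
Qed.

Lemma hereditary_subset (G : sgraph) (S T : {set G}) :
  S \subset T -> C (induced T) -> C (induced S).
Proof.
move=> sST CT.
pose S' : {set induced T} := [set x | val x \in S].
suff -> : S = val @: S' by apply/hereditary_induced_induced/hereditaryC.2.
apply/setP => x; apply/idP/imsetP => [xS|[y]]; last by rewrite inE => ? ->.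
by exists (exist _ x (subsetP sST x xS)); rewrite ?inE.
Qed.

Lemma minimal_bad_forbidden (G : sgraph) (e : {set G}) :
  ~ C (induced e) -> (forall S : {set G}, S \proper e -> C (induced S)) ->
  forbidden C (induced e).
Proof.
move=> badE minE; split=> // S propS; apply/hereditary_induced_induced/minE.
have sSe : val @: S \subset e by apply/subsetP => _ /imsetP[x _ ->]; apply: (valP x).
(* Properness passes to the image by counting, since [val] is injective. *)
rewrite properEcard sSe card_imset; last exact: val_inj.
by rewrite -card_induced -cardsT proper_card.
Qed.

(** The empty case reflects the convention on the null graph; otherwise the deleted vertex is read
    in [G]. *)
Lemma apex_induced (G : sgraph) (T : {set G}) :
  apex C (induced T) ->
  T = set0 \/ exists v, C (induced (T :\ v)).
Proof.
case=> [/eqP|[v Cv]]; first by rewrite card_induced cards_eq0 => /eqP; left.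
right; exists (val v); apply: hereditary_subset _ ((hereditary_induced_induced _).1 Cv).
apply/subsetP => x /setD1P[neq_xv xT].
apply/imsetP; exists (exist _ x xT) => //.
by rewrite !inE; apply: contraNneq neq_xv => <-.
Qed.

End Hereditary.

Theorem theorem1p2 (C : graph_class) (c : nat) :
  hereditary C ->
  bounded_order (forbidden C) ->
  is_max_order (forbidden C) c ->
  forall H : sgraph, forbidden (apex C) H -> #|H| <= ((c + 2) ^ 2) %/ 4.
Proof.
move=> herC _ [le_c _] H [not_apex apex_proper].
have H_gt0 : 0 < #|H| by rewrite lt0n; apply/eqP => H0; apply: not_apex; left.
pose bad (T : {set H}) := `[< ~ C (induced T) >].
pose F := [set e | minset bad e].
have F_small e : e \in F -> #|e| <= c.
  rewrite inE => /minsetP[/asboolP badE minE].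
  rewrite -card_induced; apply/le_c/minimal_bad_forbidden => // S propS.
  apply: contrapT => /asboolP/minE/(_ (proper_sub propS)) eqSe.
  by rewrite eqSe properxx in propS.
(* Since [H] is not apex, the complement of [v] is bad, and a minimal bad set inside it avoids
   [v]. *)
have F_free v : exists2 e, e \in F & v \notin e.
  have /minset_exists[e minE sub_e] : bad [set~ v].
    by apply/asboolP => Cv; apply: not_apex; right; exists v.
  by exists e; [rewrite inE | apply/negP => /(subsetP sub_e); rewrite !inE eqxx].
have [F' [sF'F free_F' le_cover]] := exists_small_subfamily F_small F_free.
have badF' e : e \in F' -> ~ C (induced e).
  by move/(subsetP sF'F); rewrite inE => /minsetP[/asboolP].
(* A proper cover would induce an apex graph. If deleting [v] from it gave a graph in [C], so would
   the bad member of [F'] that misses [v]. *)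
have [full|/apex_proper/(apex_induced herC)] := eqVproper (subsetT (cover F')).
  by rewrite -cardsT -full.
case=> [cover0 | [v Cv]]; last first.
  have [e eF' vNe] := free_F' v; case: (badF' e eF').
  by apply: (hereditary_subset herC _ Cv) => //; rewrite subsetD1 vNe bigcup_sup.
(* Here even the null graph is outside [C], and [H] is a single vertex. *)
have /card_gt0P[v _] := H_gt0; have [e eF' _] := free_F' v.
have bad0 : ~ C (induced (set0 : {set H})).
  move=> C0; apply: (badF' _ eF'); apply: (hereditary_subset herC _ C0).
  by rewrite -cover0 bigcup_sup.
(* A proper singleton would induce an apex graph, which would put the null graph in [C]. *)
have [full|/apex_proper/(apex_induced herC)] := eqVproper (subsetT [set v]).
  rewrite -cardsT -full cards1 leq_divRL // mul1n.
  by rewrite (@leq_exp2r 2 (c + 2) 2) // leq_addl.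
case=> [/setP/(_ v)|[u Cu]]; first by rewrite !inE eqxx.
by case: bad0; apply: hereditary_subset Cu => //; apply: sub0set.
Qed.
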